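(* Let $G=(V,E)$ be a digraph, and let $w$ be a vector in $\operatorname{Sp}(V)$. Let $\mathbb{B}_{\ge0}$ be the set of non-negative solutions of the $G$-balancing problem (viewed as matrices). Let $\Lambda$ be the diagonal matrix with $\Lambda_{ii}=w_i$. Then $$\mathbb{B}_{\ge 0}=\Lambda\,\widehat{\mathbb{A}}_G(w)=\{\Lambda A\mid A\in\widehat{\mathbb{A}}_G(w)\}.$$
   Context: Digraphs are finite and simple: no self-loops and at most one edge for each ordered pair of vertices; $V=\{1,\ldots,n\}$. $\operatorname{Sp}(V)$ is the set of vectors in $\mathbb{R}^n$ with all entries positive and summing to one. An infinitesimal stochastic matrix (ISM) is a real square matrix with non-negative off-diagonal entries whose rows each sum to zero. $\mathbb{A}_G$ is the set of $n\times n$ ISMs $A=(a_{ij})$ with $a_{ij}=0$ whenever $i\neq j$ and $i\to j$ is not an edge of $G$. $\widehat{\mathbb{A}}_G(w)=\{A\in\mathbb{A}_G\mid A^\top w=0\}$. $G$-balancing: coefficients $b_{ij}\ge 0$, $i\to j\in E$, form a (non-negative) solution of $G$-balancing if for each vertex $i$, $\sum_{k\in V_i^+}b_{ki}=\sum_{j\in V_i^-}b_{ij}$, where $V_i^+=\{k\mid k\to i\in E\}$ and $V_i^-=\{j\mid i\to j\in E\}$ are the incoming and outgoing neighbors of $i$. A non-negative solution $\{b_{ij}\mid i\to j\in E\}$ is identified with the ISM $B$ whose $ij$-th entry, $i\ne j$, is $b_{ij}$ if $i\to j\in E$ and $0$ otherwise, with diagonal entries such that each row sums to zero. *)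

(* Defs.v *)
(* MathComp world; real numbers as an abstract realType. *)
From mathcomp Require Import all_boot all_order all_algebra.
From mathcomp Require Import classical_sets reals.

Set Implicit Arguments.
Unset Strict Implicit.
Unset Printing Implicit Defensive.

Import Order.TTheory GRing.Theory Num.Theory.
Local Open Scope classical_set_scope.
Local Open Scope ring_scope.

(* [edge G i j] means that i -> j is an edge of G. *)
Record digraph (n : nat) := Digraph {
  edge : rel 'I_n;
  edge_irreflexive : irreflexive edge
}.

Definition in_nbrs n (G : digraph n) (i : 'I_n) : {set 'I_n} :=
  [set k | edge G k i]%SET.

Definition out_nbrs n (G : digraph n) (i : 'I_n) : {set 'I_n} :=
  [set j | edge G i j]%SET.

Definition Sp (R : realType) n : set 'cV[R]_n :=
  [set w | (forall i, 0 < w i ord0) /\ \sum_i w i ord0 = 1].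

(* Infinitesimal stochastic matrices. *)
Definition ISM (R : realType) n : set 'M[R]_n :=
  [set A | (forall i j, i != j -> 0 <= A i j) /\
           (forall i, \sum_j A i j = 0)].

Definition ISM_on (R : realType) n (G : digraph n) : set 'M[R]_n :=
  [set A | ISM A /\ (forall i j, i != j -> ~~ edge G i j -> A i j = 0)].

Definition ISM_on_fixing (R : realType) n (G : digraph n) (w : 'cV[R]_n) :
    set 'M[R]_n :=
  [set A | ISM_on G A /\ A^T *m w = 0].

(* A family of coefficients indexed by the edges is encoded as a total function
   of two vertices; its values at non-edges are never used. *)
Definition balancing_solution (R : realType) n (G : digraph n)
    (b : 'I_n -> 'I_n -> R) : Prop :=
  (forall i j, edge G i j -> 0 <= b i j) /\
  (forall i, \sum_(k in in_nbrs G i) b k i = \sum_(j in out_nbrs G i) b i j).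

(* The diagonal entries are the ones that make each row sum to zero. *)
Definition balancing_matrix (R : realType) n (G : digraph n)
    (b : 'I_n -> 'I_n -> R) : 'M[R]_n :=
  \matrix_(i, j) if i == j then - \sum_(k in out_nbrs G i) b i k
                 else if edge G i j then b i j else 0.

Definition balancing_matrices (R : realType) n (G : digraph n) : set 'M[R]_n :=
  [set balancing_matrix G b | b in [set b | balancing_solution G b]].

(* Main.v *)
Require Import Defs.
From mathcomp Require Import all_boot all_order all_algebra.
From mathcomp Require Import classical_sets reals.
Import Order.TTheory GRing.Theory Num.Theory.
Local Open Scope classical_set_scope.
Local Open Scope ring_scope.

(** Solutions of G-balancing are exactly the ISMs on G whose columns also sum
    to zero, that is, those fixing the all-ones vector. Scaling the rows of an
    ISM on G by nonnegative weights [d] gives an ISM on G, and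
    [(diag d * A)^T u = A^T (diag d * u)]; hence scaling by [w] carries the
    ISMs fixing [w] to those fixing the all-ones vector, and scaling by the
    inverse weights carries them back. *)

(** Meant for a row or column of a matrix supported on the edges: [S] is a neighbor set of [i],
    which misses [i] as there are no self-loops, and [F i] is the diagonal entry. *)
Lemma sum_supported_on_setU1 {V : nmodType} {I : finType} (F : I -> V)
    (i : I) (S : {set I}) :
  i \notin S -> (forall j, j != i -> j \notin S -> F j = 0) ->
  \sum_j F j = F i + \sum_(j in S) F j.
Proof.
move=> iS F0; rewrite -big_setU1 //= [RHS]big_mkcond /=.
apply: eq_bigr => j _; rewrite !inE; case: eqP => //= /eqP ji.
by case: ifPn => // /(F0 _ ji).
Qed.

Section Digraph.
Local Set Implicit Arguments.
Local Unset Strict Implicit.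
Context {R : realType} {n : nat} (G : digraph n).
Implicit Types (M : 'M[R]_n) (b : 'I_n -> 'I_n -> R).

Definition vanishes_off_edges M :=
  forall i j, i != j -> ~~ edge G i j -> M i j = 0.

Lemma row_sum_out_nbrs M i : vanishes_off_edges M ->
  \sum_j M i j = M i i + \sum_(j in out_nbrs G i) M i j.
Proof.
move=> M0; apply: sum_supported_on_setU1; first by rewrite inE edge_irreflexive.
by move=> j ji; rewrite inE; apply: M0; rewrite eq_sym.
Qed.

Lemma col_sum_in_nbrs M i : vanishes_off_edges M ->
  \sum_k M k i = M i i + \sum_(k in in_nbrs G i) M k i.
Proof.
move=> M0; apply: (sum_supported_on_setU1 (fun k => M k i)).
  by rewrite inE edge_irreflexive.
by move=> k ki; rewrite inE; apply: M0.
Qed.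

Lemma edge_neq i j : edge G i j -> i != j.
Proof. by apply: contraTneq => ->; rewrite edge_irreflexive. Qed.

Lemma balancing_matrix_diag b i :
  balancing_matrix G b i i = - \sum_(k in out_nbrs G i) b i k.
Proof. by rewrite mxE eqxx. Qed.

Lemma balancing_matrix_edge b i j : edge G i j -> balancing_matrix G b i j = b i j.
Proof. by move=> ij; rewrite mxE (negPf (edge_neq ij)) ij. Qed.

Lemma balancing_matrix_off_edges b : vanishes_off_edges (balancing_matrix G b).
Proof. by move=> i j /negPf ij /negPf nij; rewrite mxE ij nij. Qed.

Lemma trmx_mul_ones_eq0 M :
  M^T *m const_mx 1 = 0 :> 'cV[R]_n <-> forall i, \sum_k M k i = 0.
Proof.
have colE i : (M^T *m const_mx 1 : 'cV[R]_n) i ord0 = \sum_k M k i.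
  by rewrite mxE; apply: eq_bigr => k _; rewrite !mxE mulr1.
split=> [M1 i|M1]; first by rewrite -colE M1 mxE.
by apply/colP => i; rewrite colE M1 mxE.
Qed.

(** Zero row sums force each diagonal entry to be minus the outflow of its vertex, so the sum of
    column [i] is inflow minus outflow at [i]. *)
Lemma balancing_matricesE :
  balancing_matrices G = ISM_on_fixing G (const_mx 1 : 'cV[R]_n).
Proof.
apply/seteqP; split => [_ [b [b_ge0 b_bal] <-]|M [[[M_ge0 M_row] M0] M_col]].
- have B0 := balancing_matrix_off_edges b.
  split; last first.
    apply/trmx_mul_ones_eq0 => i; rewrite col_sum_in_nbrs // balancing_matrix_diag.
    (* Balance at [i] turns the diagonal entry into minus the inflow, which cancels the rest of the
       column. *)
    rewrite -b_bal addrC; apply/eqP; rewrite subr_eq0; apply/eqP.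
    by apply: eq_bigr => k; rewrite inE => /balancing_matrix_edge.
  split=> //; split=> [i j ij|i].
    by rewrite mxE (negPf ij); case: ifP => // /b_ge0.
  rewrite row_sum_out_nbrs // balancing_matrix_diag addrC.
  apply/eqP; rewrite subr_eq0; apply/eqP.
  by apply: eq_bigr => k; rewrite inE => /balancing_matrix_edge.
- have diagE i : M i i = - \sum_(j in out_nbrs G i) M i j.
    by apply/eqP; rewrite -addr_eq0 -row_sum_out_nbrs // M_row.
  (* Only the values of this witness on edges matter, so the diagonal of [M] does no harm. *)
  exists (fun i j => M i j).
    split=> [i j ij|i]; first exact/M_ge0/edge_neq.
    (* Adding the diagonal entry completes inflow and outflow to a column sum and a row sum, both
       zero. *)
    apply/(addrI (M i i)).
    rewrite -col_sum_in_nbrs // -row_sum_out_nbrs // M_row.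
    by move/trmx_mul_ones_eq0: M_col.
  apply/matrixP => i j; rewrite mxE; case: eqVneq => [<-|ij]; first by rewrite diagE.
  by case: ifPn => // /(M0 _ _ ij).
Qed.

Lemma ISM_on_fixing_diag_mul (d : 'rV[R]_n) (u : 'cV[R]_n) M :
  (forall i, 0 <= d ord0 i) ->
  ISM_on_fixing G (diag_mx d *m u) M -> ISM_on_fixing G u (diag_mx d *m M).
Proof.
move=> d_ge0 [[[M_ge0 M_row] M0] Mdu].
split; last by rewrite trmx_mul tr_diag_mx -mulmxA.
split; first split=> [i j ij|i].
- by rewrite mul_diag_mx mxE mulr_ge0 ?M_ge0.
- under eq_bigr do rewrite mul_diag_mx mxE.
  by rewrite -mulr_sumr M_row mulr0.
- by move=> i j ij nij; rewrite mul_diag_mx mxE M0 ?mulr0.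
Qed.

End Digraph.

Theorem lemma16 (R : realType) (n : nat) (G : digraph n) (w : 'cV[R]_n)
    (hw : Sp w) :
  balancing_matrices G = [set diag_mx w^T *m A | A in ISM_on_fixing G w].
Proof.
have [w_gt0 _] := hw.
(* The inverse weights; positivity of [w] makes them genuine inverses. *)
pose v : 'rV[R]_n := \row_i (w i ord0)^-1.
have v_ge0 i : 0 <= v ord0 i by rewrite mxE invr_ge0 ltW.
have wv : diag_mx w^T *m diag_mx v = 1%:M.
  rewrite mulmx_diag -diag_const_mx; congr diag_mx; apply/rowP => i.
  by rewrite !mxE divff ?gt_eqF.
have w1 : diag_mx w^T *m const_mx 1 = w.
  by apply/colP => i; rewrite mul_diag_mx !mxE mulr1.
rewrite balancing_matricesE; apply/seteqP; split => [B fixB|_ [A fixA <-]].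
- exists (diag_mx v *m B); last by rewrite mulmxA wv mul1mx.
  apply: ISM_on_fixing_diag_mul => //.
  (* Scaling [w] by its inverse weights gives the all-ones vector, which [B] fixes. *)
  by rewrite -w1 mulmxA (mulmx1C wv) mul1mx.
- apply: ISM_on_fixing_diag_mul; last by rewrite w1.
  by move=> i; rewrite mxE ltW.
Qed.
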